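(* Let $G$ be an inconsistently oriented cycle graph on $n\ge 3$ vertices, let $M$ be the maximum of the finite weights of its $n$ edges, and let $K$ be a minimal source dominating set of $P(G)$. If $|K|\ge 3$, then for all finite $\delta\ge M$ the first homology $H_1(\mathfrak{D}_\delta(G))$ is generated by one nontrivial class (it is one-dimensional), and for all $0\le \delta<M$ it is trivial.
   Context: A network $G=(X,\omega)$ is a finite vertex set $X$ with $\omega:X\times X\to[0,\infty]$. The weight of a path $(x_0,\dots,x_m)$ is $\sum_i\omega(x_i,x_{i+1})$ ($0$ for a constant path), $d(x,y)$ is the infimum of the weights of paths from $x$ to $y$, and $P(G)=(X,d)$ is the path completion. For finite real $\delta\ge0$, $\mathfrak{D}_\delta(G)$ is the simplicial complex on $X$ whose simplices are the nonempty $\sigma\subseteq X$ for which there is $y\in X$ with $d(y,x)\le\delta$ for all $x\in\sigma$. A cycle graph is a network on $\mathbb{Z}/n\mathbb{Z}$ whose underlying undirected graph is the $n$-cycle with each edge given one orientation: for each $i$ exactly one of $\omega(i,i+1),\omega(i+1,i)$ is finite, and $\omega(i,j)=\infty$ for all other pairs $i\ne j$. It is inconsistently oriented if its edges are not all oriented in the same direction around the cycle. A source dominating set of $P(G)$ is a set $K$ of vertices such that every vertex $x$ satisfies $d(k,x)<\infty$ for some $k\in K$; it is minimal if no strict subset is source dominating. Homology has real coefficients. *)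

(* Defs.v *)
From HB Require Import structures.
From mathcomp Require Import all_boot all_order all_algebra.
From mathcomp Require Import all_classical reals ereal.

Set Implicit Arguments.
Unset Strict Implicit.
Unset Printing Implicit Defensive.

Import Order.TTheory GRing.Theory Num.Theory.

Local Open Scope ring_scope.

Section QuotientSpace.
Local Open Scope quotient_scope.
Variables (F : fieldType) (V : vectType F) (U : {vspace V}).

(* [ring_quotient] only equips the quotient by U with a zmodType structure;
   the scaling is added here. *)
Definition vquot : Type := Quotient.quot (pred_of_vspace U).

HB.instance Definition _ := GRing.Zmodule.on vquot.
HB.instance Definition _ := EqQuotient.on vquot.

Definition vquot_pi (v : V) : vquot := \pi_vquot v.

Lemma vquot_piE (v w : V) : (vquot_pi v = vquot_pi w) <-> (v - w \in U).
Proof.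
by rewrite /vquot_pi; split=> [/eqmodP|h] //; apply/eqmodP.
Qed.

Lemma vquot_pi_repr (q : vquot) : vquot_pi (repr q) = q.
Proof. exact: reprK. Qed.

Lemma vquot_piD : {morph vquot_pi : v w / v + w}.
Proof. by move=> v w; rewrite /vquot_pi; exact: pi_addr. Qed.

Definition vquot_scale (a : F) (q : vquot) : vquot := vquot_pi (a *: repr q).

Lemma vquot_piZ a v : vquot_pi (a *: v) = vquot_scale a (vquot_pi v).
Proof.
apply/vquot_piE; rewrite -scalerBr memvZ //.
by apply/vquot_piE; rewrite vquot_pi_repr.
Qed.

Fact vquot_scaleA a b q :
  vquot_scale a (vquot_scale b q) = vquot_scale (a * b) q.
Proof. by rewrite -[q]vquot_pi_repr -!vquot_piZ scalerA. Qed.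

Fact vquot_scale1 : left_id 1 vquot_scale.
Proof. by move=> q; rewrite -[q]vquot_pi_repr -!vquot_piZ scale1r. Qed.

Fact vquot_scaleDr : right_distributive vquot_scale +%R.
Proof.
move=> a q q'; rewrite -[q]vquot_pi_repr -[q']vquot_pi_repr.
by rewrite -vquot_piD -!vquot_piZ scalerDr vquot_piD.
Qed.

Fact vquot_scaleDl q : {morph vquot_scale^~ q : a b / a + b}.
Proof.
by move=> a b; rewrite -[q]vquot_pi_repr -!vquot_piZ scalerDl vquot_piD.
Qed.

HB.instance Definition _ := GRing.Zmodule_isLmodule.Build F vquot
  vquot_scaleA vquot_scale1 vquot_scaleDr vquot_scaleDl.

End QuotientSpace.

Record simplicial_complex (X : finType) := SimplicialComplex {
  simplices :> {set {set X}};
  simplices_neq0 : finset.set0 \notin simplices;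
  simplices_sub : forall s t : {set X},
    s \in simplices -> t \subset s -> t != finset.set0 -> t \in simplices }.

Section Homology.
Variables (R : realFieldType) (X : finType) (C : simplicial_complex X).

(* Simplices are graded by their number of vertices, so [simplex_type m] is the
   type of (m-1)-dimensional simplices; it is empty for m = 0. *)
Definition simplex_type (m : nat) : finType :=
  {s : {set X} | (s \in (C : {set {set X}})) && (#|s| == m)}.

Definition chains (m : nat) : vectType R := {ffun simplex_type m -> R^o}.

(* Every simplex is oriented by the enumeration order of X; the face s :\ v
   carries the sign (-1)^p, where p is the position of v among the vertices. *)
Definition face_sign (s : {set X}) (v : X) : R :=
  (-1) ^+ #|[set u in s | (enum_rank u < enum_rank v)%N]|.

Definition boundary_fun (m : nat) (c : chains m.+1) : chains m :=
  [ffun t => \sum_(s : simplex_type m.+1)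
     \sum_(v in val s | val s :\ v == val t) face_sign (val s) v * c s].

Fact boundary_fun_linear m : linear (@boundary_fun m).
Proof.
move=> a c c'; apply/ffunP=> t; rewrite !ffunE scaler_sumr -big_split /=.
apply: eq_bigr => s _; rewrite scaler_sumr -big_split /=.
by apply: eq_bigr => v _; rewrite !ffunE mulrDr; congr (_ + _); rewrite /GRing.scale /= mulrCA.
Qed.

HB.instance Definition _ m :=
  GRing.isLinear.Build R (chains m.+1) (chains m) _ (@boundary_fun m)
    (@boundary_fun_linear m).

Definition boundary (m : nat) : 'Hom(chains m.+1, chains m) :=
  linfun (@boundary_fun m).

Lemma face_signC (s : {set X}) v w : v \in s -> w \in s -> v != w ->
  face_sign (s :\ v) w * face_sign s v =
  - (face_sign (s :\ w) v * face_sign s w).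
Proof.
pose below (t : {set X}) (x : X) : {set X} := [set u in t | (enum_rank u < enum_rank x)%N].
have below_lt x y : y \in s -> (enum_rank y < enum_rank x)%N ->
    #|below s x| = #|below (s :\ y) x|.+1.
  move=> ys yx; rewrite (cardsD1 y) !inE ys yx add1n; congr _.+1.
  by apply: eq_card => u; rewrite !inE andbA.
have below_ge x y : (enum_rank x <= enum_rank y)%N ->
    #|below (s :\ y) x| = #|below s x|.
  move=> xy; apply: eq_card => u; rewrite !inE; case: eqP => [->|//].
  by rewrite ltnNge xy /= !andbF.
rewrite /face_sign => vs ws vw; rewrite -!exprD.
rewrite -/(below s v) -/(below s w) -/(below (s :\ v) w) -/(below (s :\ w) v).
have: (enum_rank v : nat) != enum_rank w.
  by rewrite (inj_eq val_inj) (inj_eq enum_rank_inj).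
rewrite neq_ltn => /orP[h|h].
  rewrite (below_lt _ _ vs h) (below_ge _ _ (ltnW h)).
  move: #|below s v| #|below (s :\ v) w| => p q.
  by rewrite addnS exprS mulN1r opprK addnC.
rewrite (below_lt _ _ ws h) (below_ge _ _ (ltnW h)).
move: #|below s w| #|below (s :\ w) v| => p q.
by rewrite addnS exprS mulN1r addnC.
Qed.

Lemma boundaryK m (c : chains m.+2) : boundary m (boundary m.+1 c) = 0.
Proof.
rewrite /boundary !lfunE; apply/ffunP => r; rewrite !ffunE /=.
pose F (s : simplex_type m.+2) v w : R :=
  face_sign (val s :\ v) w * face_sign (val s) v * c s.
transitivity (\sum_(s : simplex_type m.+2)
    \sum_(v in val s) \sum_(w in val s | (v != w) && (val s :\ v :\ w == val r))
      F s v w).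
  under eq_bigr => t _.
    under eq_bigr => w _.
      rewrite ffunE mulr_sumr.
      over.
    rewrite exchange_big /=.
    over.
  rewrite exchange_big /=; apply: eq_bigr => s _.
  under eq_bigr => t _.
    under eq_bigr => w _ do rewrite mulr_sumr.
    rewrite exchange_big /=.
    rewrite (eq_bigl (fun v => (v \in val s) && (val s :\ v == val t))) //.
    rewrite big_mkcondr /=.
    over.
  rewrite exchange_big /=; apply: eq_bigr => v vs.
  have st : (val s :\ v \in (C : {set {set X}})) && (#|val s :\ v| == m.+1).
    have /andP[sC /eqP sm] := valP s.
    have cv : #|val s :\ v| = m.+1 by move: sm; rewrite (cardsD1 v (val s)) vs => -[].
    rewrite cv eqxx andbT; apply: (simplices_sub sC); first exact: subD1set.
    by rewrite -card_gt0 cv.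
  rewrite (bigD1 (Sub (val s :\ v) st : simplex_type m.+1)) //=.
  rewrite eqxx [X in _ + X]big1 ?addr0; last first.
    move=> t; rewrite -val_eqE /= eq_sym => /negPf; rewrite /= => ->. by [].
  apply: eq_big => [w|w _]; last by rewrite /F mulrA.
  by rewrite !inE (eq_sym w v) -andbA andbCA.
rewrite big1 // => s _.
pose P v w := (v \in val s) && ((w \in val s) && ((v != w) && (val s :\ v :\ w == val r))).
have E : \sum_(v in val s) \sum_(w in val s | (v != w) && (val s :\ v :\ w == val r)) F s v w
   = \sum_v \sum_(w | P v w) F s v w.
  rewrite big_mkcond /=; apply: eq_bigr => v _; rewrite /P; case: (v \in val s) => //=.
  by rewrite big_pred0.
rewrite E; set T := LHS; suff: T = - T.
  by move/eqP; rewrite -subr_eq0 opprK -mulr2n mulrn_eq0 /= => /eqP.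
rewrite {1}/T (exchange_big_dep xpredT) //= -sumrN.
apply: eq_bigr => v _; rewrite -sumrN; apply: eq_big => [w|w].
  rewrite /P (eq_sym w v) andbCA; congr [&& _, _, _ & _ == _].
  by apply/setP => u; rewrite !inE andbCA.
by case/and4P => vs ws vw _; rewrite /F face_signC // 1?eq_sym // mulNr.
Qed.

Definition cycles (k : nat) : {vspace chains k.+1} := lker (boundary k).

Definition boundaries (k : nat) : {vspace chains k.+1} := limg (boundary k.+1).

Fact boundaries_sub_cycles k : (boundaries k <= cycles k)%VS.
Proof.
apply/subvP => _ /memv_imgP[c _ ->].
by rewrite memv_ker; apply/eqP; apply: boundaryK.
Qed.

Definition homology (k : nat) : lmodType R :=
  vquot (linfun (vsval : subvs_of (cycles k) -> chains k.+1)
           @^-1: boundaries k)%VS.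

End Homology.

Section Networks.
Variable (R : realType).
Local Open Scope ereal_scope.

Record network (X : finType) := Network {
  weight :> X -> X -> \bar R;
  weight_ge0 : forall x y, 0 <= weight x y }.

Section Completion.
Variables (X : finType) (G : network X).

(* The weight of the path (x, p_0, ..., p_{m-1}). *)
Definition path_weight (x : X) (p : seq X) : \bar R :=
  \sum_(w <- pairmap G x p) w.

Definition path_dist (x y : X) : \bar R :=
  ereal_inf [set path_weight x p | p in [set p : seq X | last x p = y]]%classic.

Fact path_weight_ge0 x p : 0 <= path_weight x p.
Proof.
rewrite /path_weight; elim: p x => [|y p IH] x /=; first by rewrite big_nil.
by rewrite big_cons adde_ge0 ?weight_ge0.
Qed.

Fact path_dist_ge0 x y : 0 <= path_dist x y.
Proof. by apply: le_ereal_inf_tmp => _ [p _ <-]; apply: path_weight_ge0. Qed.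

Definition path_completion : network X := Network path_dist_ge0.

Variable delta : R.

Definition dowker_simplices : {set {set X}} :=
  [set s : {set X} | (s != finset.set0) &&
    [exists y, [forall x in s, path_completion y x <= delta%:E]]].

Fact dowker_simplices_neq0 : finset.set0 \notin dowker_simplices.
Proof. by rewrite inE eqxx. Qed.

Fact dowker_simplices_sub (s t : {set X}) :
  s \in dowker_simplices -> t \subset s -> t != finset.set0 ->
  t \in dowker_simplices.
Proof.
rewrite !inE => /andP[_ /existsP[y /forall_inP ys]] /fintype.subsetP ts ->.
by apply/existsP; exists y; apply/forall_inP => x /ts; apply: ys.
Qed.

Definition dowker_complex : simplicial_complex X :=
  SimplicialComplex dowker_simplices_neq0 dowker_simplices_sub.

End Completion.

Definition source_dominating (X : finType) (D : network X) (K : {set X}) : bool :=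
  [forall x, [exists k in K, D k x < +oo]].

(* The vertex set Z/n is 'I_n, and [ordS] is the cyclic successor i |-> i + 1. *)
Definition cycle_graph (n : nat) (G : network 'I_n) : Prop :=
  (forall i, (G i (ordS i) < +oo) (+) (G (ordS i) i < +oo)) /\
  (forall i j, i != j -> j != ordS i -> i != ordS j -> G i j = +oo).

Definition inconsistently_oriented (n : nat) (G : network 'I_n) : Prop :=
  ~ (forall i, G i (ordS i) < +oo) /\ ~ (forall i, G (ordS i) i < +oo).

(* Loops G i i do not contribute. *)
Definition edge_weights (n : nat) (G : network 'I_n) : set R :=
  [set w | exists i, G i (ordS i) = w%:E \/ G (ordS i) i = w%:E]%classic.

Definition max_edge_weight (n : nat) (G : network 'I_n) (M : R) : Prop :=
  edge_weights G M /\ ubound (edge_weights G) M.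

End Networks.

(* Main.v *)
(* Balls of d are arcs of the cycle: two vertices missed by a ball cut the cycle
   in two, and a path leaving the centre's side would have to enter one of them.
   Distinct members of K do not reach each other, while each ball is reached from
   a single one, so as |K| >= 3 any two balls miss a common vertex.

   Cutting along an arc, every 1-chain is homologous to one supported on the
   edges {i, i+1}; a cycle so supported is determined by its value on any one
   of them.  Hence H_1 has dimension at most 1, and is 0 as soon as some {i, i+1}
   is not a simplex, which happens for delta < M at an edge of weight M.  For
   delta >= M the oriented sum of all edges is a cycle, and the number of times a chain
   crosses from n-1 to 0 is a cocycle not vanishing on it: this number is well
   defined on simplices because no two balls cover the cycle. *)
From HB Require Import structures.
Require Import Defs.
From mathcomp Require Import all_boot all_order all_algebra.
From mathcomp Require Import all_classical reals ereal.
From mathcomp Require Import zify ring.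

Set Implicit Arguments.
Unset Strict Implicit.
Unset Printing Implicit Defensive.

Import Order.TTheory GRing.Theory Num.Theory.

Local Open Scope ring_scope.

(** * Homology classes in terms of cycles and boundaries *)

Section Quotient.
Variables (R : realFieldType) (X : finType) (C : simplicial_complex X).
Variable k : nat.

Lemma vquot_pi0 (F : fieldType) (V : vectType F) (U : {vspace V}) :
  vquot_pi U 0 = 0.
Proof. by apply: (addrI (vquot_pi U 0)); rewrite -vquot_piD !addr0. Qed.

Lemma homology_eq (z z' : subvs_of (cycles R C k)) :
  vsval z - vsval z' \in boundaries R C k ->
  vquot_pi (linfun (vsval : subvs_of (cycles R C k) -> chains R C k.+1)
           @^-1: boundaries R C k)%VS z = vquot_pi _ z'.
Proof. by move=> h; apply/vquot_piE; rewrite -memv_preim linearB /= !lfunE. Qed.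

Lemma homology_eq0 :
  (forall z, z \in cycles R C k -> z \in boundaries R C k) ->
  forall h : homology R C k, h = 0.
Proof.
move=> zb h; rewrite -[h]vquot_pi_repr -[RHS]vquot_pi0.
by apply: homology_eq; rewrite (linear0 (vsval (U := cycles R C k))) subr0 zb ?subvsP.
Qed.

Lemma homology_line (g : chains R C k.+1) :
  g \in cycles R C k -> g \notin boundaries R C k ->
  (forall z, z \in cycles R C k -> exists c, z - c *: g \in boundaries R C k) ->
  exists h : homology R C k, h <> 0 /\ forall h', exists c : R, h' = c *: h.
Proof.
move=> gz gb zg; pose g' := vsproj (cycles R C k) g.
exists (vquot_pi _ g'); split.
  move/eqP; rewrite -[X in _ == X]vquot_pi0 => /eqP/vquot_piE.
  by rewrite subr0 -memv_preim lfunE /= vsprojK // (negPf gb).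
move=> h'; have [c hc] := zg _ (subvsP (repr h')).
exists c; rewrite -[LHS]vquot_pi_repr.
transitivity (vquot_pi ((linfun (vsval : subvs_of (cycles R C k) -> chains R C k.+1)
           @^-1: boundaries R C k)%VS) (c *: g')); last exact: vquot_piZ.
by apply: homology_eq; rewrite linearZ_LR /= vsprojK // scalerN.
Qed.

End Quotient.

(** * Elementary chains and cochains *)

Section Chains.
Variables (R : realFieldType) (X : finType) (C : simplicial_complex X).

(** Indexed by a bare vertex set, so that a face can be named without a proof that it is a simplex;
    the chain is 0 when [s] is not a simplex on [m] vertices. *)
Definition simplex_chain m (s : {set X}) : chains R C m :=
  [ffun t => (val t == s)%:R].

Lemma chain_sum m (c : chains R C m) :
  c = \sum_(s : simplex_type C m) c s *: simplex_chain m (val s).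
Proof.
apply/ffunP => t; rewrite sum_ffunE (bigD1 t) //= !ffunE eqxx.
rewrite big1 ?addr0 => [|s st]; first by rewrite /GRing.scale /= mulr1.
by rewrite !ffunE val_eqE eq_sym (negPf st) scaler0.
Qed.

Lemma boundary_simplex m (s : simplex_type C m.+1) :
  boundary R C m (simplex_chain m.+1 (val s)) =
  \sum_(v in val s) face_sign R (val s) v *: simplex_chain m (val s :\ v).
Proof.
rewrite lfunE; apply/ffunP => t; rewrite ffunE sum_ffunE.
rewrite (bigD1 s) //= [X in _ + X]big1 ?addr0; last first.
  move=> s' s's; apply: big1 => v _.
  by rewrite ffunE val_eqE (negPf s's) mulr0.
rewrite big_mkcondr /=; apply: eq_bigr => v _; rewrite !ffunE eqxx mulr1.
by rewrite (eq_sym (val t)); case: eqP => _; rewrite ?scaler0 // /GRing.scale /= mulr1.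
Qed.

Lemma face_sign_neq0 (s : {set X}) v : face_sign R s v != 0.
Proof. by rewrite /face_sign signr_eq0. Qed.

Definition cochain (f : {set X} -> R) m (c : chains R C m) : R :=
  \sum_(s : simplex_type C m) f (val s) * c s.

Lemma cochain_simplex f m (s : simplex_type C m) :
  cochain f (simplex_chain m (val s)) = f (val s).
Proof.
rewrite /cochain (bigD1 s) //= ffunE eqxx mulr1 big1 ?addr0 // => t ts.
by rewrite ffunE val_eqE (negPf ts) mulr0.
Qed.

Fact cochain_linear f m : linear_for *%R (@cochain f m).
Proof.
move=> a c c'; rewrite /cochain mulr_sumr -big_split; apply: eq_bigr => s _ /=.
by rewrite !ffunE /GRing.scale /= mulrDr mulrCA.
Qed.

HB.instance Definition _ f m :=
  GRing.isLinear.Build R (chains R C m) R *%R (@cochain f m)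
    (@cochain_linear f m).

(** By linearity only single simplices matter, and on these the hypothesis is the cocycle
    condition. *)
Lemma cochain_boundary f m (c : chains R C m.+2) :
  (forall s : simplex_type C m.+2,
     \sum_(v in val s) face_sign R (val s) v * f (val s :\ v) = 0) ->
  cochain f (boundary R C m.+1 c) = 0.
Proof.
move=> f0; rewrite [c]chain_sum !linear_sum big1 // => s _.
rewrite !linearZ /= boundary_simplex linear_sum /=.
rewrite (eq_bigr (fun v => face_sign R (val s) v * f (val s :\ v))) ?f0 ?mulr0 //.
move=> v vs; rewrite linearZ /=; congr (_ * _).
have st : (val s :\ v \in (C : {set {set X}})) && (#|val s :\ v| == m.+1).
  have /andP[sC /eqP sm] := valP s.
  have cv : #|val s :\ v| = m.+1 by move: sm; rewrite (cardsD1 v (val s)) vs => -[].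
  rewrite cv eqxx andbT; apply: (simplices_sub sC); first exact: subD1set.
  by rewrite -card_gt0 cv.
exact: (cochain_simplex f (Sub (val s :\ v) st : simplex_type C m.+1)).
Qed.

End Chains.

(** * Order and separation on the cycle *)

Lemma ordS_cases n (i : 'I_n) :
  (i.+1 < n /\ ordS i = i.+1 :> nat \/ i.+1 = n /\ ordS i = 0 :> nat)%N.
Proof.
rewrite /=; have := ltn_ord i; rewrite leq_eqVlt => /orP[/eqP h|h].
  by right; rewrite h modnn.
by left; rewrite modn_small.
Qed.

(** Face signs depend on the order of the vertices, so triangles are wanted with sorted vertices. *)
Lemma card3P (n : nat) (s : {set 'I_n}) : #|s| = 3 ->
  exists x y z : 'I_n, [/\ (x < y)%N, (y < z)%N & s = [set x; y; z]].
Proof.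
have sortP (x y z : 'I_n) : x != y -> y != z -> x != z ->
  exists x' y' z' : 'I_n, [/\ (x' < y')%N, (y' < z')%N & [set x; y; z] = [set x'; y'; z']].
  rewrite -!val_eqE /= => xy yz xz.
  have perm (a b c : 'I_n) : (a < b)%N -> (b < c)%N ->
      [set x; y; z] =i [set a; b; c] -> exists x' y' z' : 'I_n,
      [/\ (x' < y')%N, (y' < z')%N & [set x; y; z] = [set x'; y'; z']].
    by move=> ab bc /setP abc; exists a, b, c.
  have [h1|h1] := ltnP x y; have [h2|h2] := ltnP y z; have [h3|h3] := ltnP x z;
    [ apply: (perm x y z) | lia | apply: (perm x z y) | apply: (perm z x y)
    | apply: (perm y x z) | apply: (perm y z x) | lia | apply: (perm z y x) ];
    by [lia | move=> u; rewrite !inE; do !case: eqP].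
move=> s3.
have /card_gt0P[x xs] : (0 < #|s|)%N by rewrite s3.
have s2 : #|s :\ x| = 2 by move: s3; rewrite (cardsD1 x) xs => -[].
have /cards2P[y [z [yz syz]]] : #|s :\ x| == 2 by rewrite s2.
have se : s = [set x; y; z] by rewrite -(finset.setD1K xs) syz finset.setUA.
rewrite se; apply: sortP => //; apply/eqP => xu.
  by move/setP/(_ y): syz; rewrite !inE xu eqxx.
by move/setP/(_ z): syz; rewrite !inE xu eqxx orbT.
Qed.

(** Of the two arcs into which [v] and [w] cut the cycle, this selects the one that does not wrap
    from n-1 to 0. Two other vertices lie on the same arc when their values agree. *)
Definition separates (v w x : nat) := (v < x < w)%N || (w < x < v)%N.

(** Two points fail to separate [x] from [y] when both or neither lie strictly between them. As [q']
    lies between, so does [r], and hence so does [q]. *)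
Lemma not_separated_between (x y q q' r : nat) : (x < y)%N -> (x < q' < y)%N ->
  x != r -> y != r -> x != q -> y != q ->
  separates q r x = separates q r y -> separates q' r x = separates q' r y ->
  (x < q < y)%N.
Proof. rewrite /separates; lia. Qed.

(** * The cycle cut open at a vertex *)

Section Cut.
Variable n : nat.
Implicit Types q u i : 'I_n.

(* Position of [u] in the linear order obtained by cutting the cycle at [q]. *)
Definition cut q u : nat := if (u < q)%N then (u + n)%N else u.

Lemma cut_ordS q u : u != q -> ordS u != q -> cut q (ordS u) = (cut q u).+1.
Proof.
rewrite -!(inj_eq (@ord_inj n)) => uq Suq; have := ordS_cases u; have := ltn_ord q.
have := ltn_ord u; rewrite /cut => un qn Su; do 2 case: ltnP => ?; lia.
Qed.

Lemma cut_inj q : injective (cut q).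
Proof.
move=> u u'; rewrite /cut => e; apply: ord_inj; move: e.
have := ltn_ord u; have := ltn_ord u' => ? ?; do 2 case: ltnP => ?; lia.
Qed.

(** Only the last vertex of the cut order is followed by [q], and [u] has [i] after it. *)
Lemma cut_lt_ordS q u i : u != q -> (cut q u < cut q i)%N -> ordS u != q.
Proof.
rewrite -!(inj_eq (@ord_inj n)) => uq; rewrite /cut.
have := ordS_cases u; have := ltn_ord q; have := ltn_ord u; have := ltn_ord i.
by move=> iin un qn Su; case: (ltnP u q) => ?; case: (ltnP i q) => ?; lia.
Qed.

(** A step avoiding [q] changes the position by exactly one, so the position of [i] can be passed
    upwards only from [i] itself. *)
Lemma cut_step q u u' i : u != q -> u' != q -> i != q -> ordS i != q ->
  u' = ordS u \/ u = ordS u' -> (cut q u <= cut q i)%N -> (cut q i < cut q u')%N ->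
  u = i /\ u' = ordS i.
Proof.
move=> uq u'q iq Siq [] e; last first.
  by rewrite e cut_ordS -?e //; lia.
rewrite e cut_ordS -?e // => h1 h2.
have ui : u = i by apply: (@cut_inj q); lia.
by rewrite e ui.
Qed.

End Cut.

(** * Signs and faces of edges and triangles *)

Section Signs.
Variables (R : realFieldType) (n : nat).
Implicit Types x y z : 'I_n.

Lemma big_set2 (V : zmodType) (x y : 'I_n) (F : 'I_n -> V) :
  x != y -> \sum_(v in [set x; y]) F v = F x + F y.
Proof. by move=> xy; rewrite big_setU1 ?inE //= big_set1. Qed.

Lemma face_sign3 x y z : (x < y)%N -> (y < z)%N ->
  ((face_sign R [set x; y; z] x = 1) * (face_sign R [set x; y; z] y = -1)) *
  (face_sign R [set x; y; z] z = 1).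
Proof.
move=> xy yz; rewrite /face_sign !enum_rank_ord /=; split; first split.
- rewrite (_ : [set _ in _ | _] = finset.set0) ?cards0 //.
  apply/setP => u; rewrite !inE !enum_rank_ord -!val_eqE /=; lia.
- rewrite (_ : [set _ in _ | _] = [set x]) ?cards1 ?expr1 //.
  apply/setP => u; rewrite !inE !enum_rank_ord -!val_eqE /=; lia.
rewrite (_ : [set _ in _ | _] = [set x; y]).
  by rewrite cards2 -val_eqE /= ltn_eqF //= expr2 mulrNN mulr1.
apply/setP => u; rewrite !inE !enum_rank_ord -!val_eqE /=; lia.
Qed.

Lemma face_sign2 x y : (x < y)%N ->
  (face_sign R [set x; y] x = 1) * (face_sign R [set x; y] y = -1).
Proof.
move=> xy; rewrite /face_sign !enum_rank_ord /=; split.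
  rewrite (_ : [set _ in _ | _] = finset.set0) ?cards0 //.
  apply/setP => u; rewrite !inE !enum_rank_ord -!val_eqE /=; lia.
rewrite (_ : [set _ in _ | _] = [set x]) ?cards1 ?expr1 //.
apply/setP => u; rewrite !inE !enum_rank_ord -!val_eqE /=; lia.
Qed.

Lemma setD_pair x y : x != y -> ([set x; y] :\ x = [set y]) * ([set x; y] :\ y = [set x]).
Proof.
by rewrite -val_eqE /= => xy; split; apply/setP => u; rewrite !inE -!val_eqE /=; lia.
Qed.

Lemma setD_triple x y z : x != y -> y != z -> x != z ->
  ([set x; y; z] :\ x = [set y; z]) * ([set x; y; z] :\ y = [set x; z]) *
  ([set x; y; z] :\ z = [set x; y]).
Proof.
rewrite -!val_eqE /= => xy yz xz.
by split; first split; apply/setP => u; rewrite !inE -!val_eqE /=; lia.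
Qed.

End Signs.

(** * First homology of a complex generated by arcs of the cycle *)

Section CycleComplex.
Variables (R : realFieldType) (n : nat) (n_ge3 : (2 < n)%N).
Variables (B : 'I_n -> {set 'I_n}) (C : simplicial_complex 'I_n).
Hypothesis CP : forall s : {set 'I_n},
  s \in (C : {set {set 'I_n}}) <-> s != finset.set0 /\ exists y, s \subset B y.
Hypothesis B_arc : forall y v w x x' : 'I_n, v \notin B y -> w \notin B y ->
  x \in B y -> x' \in B y -> separates v w x = separates v w x'.
Hypothesis B_miss : forall y y', exists2 q, q \notin B y & q \notin B y'.

Definition arc_edge (s : {set 'I_n}) := [exists i, s == [set i; ordS i]].

(* [z] is supported on the edges {i, i+1} modulo boundaries. *)
Definition arc_reducible (z : chains R C 2) :=
  exists d : chains R C 3, forall s, ~~ arc_edge (val s) -> z s = boundary R C 2 d s.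

Lemma arc_reducible_lin a z z' :
  arc_reducible z -> arc_reducible z' -> arc_reducible (a *: z + z').
Proof.
move=> [d dE] [d' d'E]; exists (a *: d + d') => s ns.
by rewrite linearP !ffunE dE // d'E.
Qed.

Lemma arc_reducible0 : arc_reducible 0.
Proof. by exists 0 => s _; rewrite linear0. Qed.

Lemma arc_reducible_sum (I : finType) (P : pred I) (f : I -> R) (F : I -> chains R C 2) :
  (forall i, P i -> arc_reducible (F i)) ->
  arc_reducible (\sum_(i | P i) f i *: F i).
Proof.
move=> PF; elim/big_rec: _ => [|i z Pi zP]; first exact: arc_reducible0.
by apply: arc_reducible_lin => //; apply: PF.
Qed.

Lemma arc_edge_reducible s : arc_edge s -> arc_reducible (simplex_chain R C 2 s).
Proof.
move=> As; exists 0 => t nt; rewrite linear0 !ffunE.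
by case: eqP => // ts; rewrite ts As in nt.
Qed.

(** The boundary of [s] is reducible, with [s] itself as witness. Solving it for the face opposite
    [v0], whose sign is invertible, leaves only the other faces. *)
Lemma face_reducible (s : {set 'I_n}) v0 : s \in (C : {set {set 'I_n}}) -> #|s| = 3 ->
  v0 \in s ->
  (forall v, v \in s -> v != v0 -> arc_reducible (simplex_chain R C 2 (s :\ v))) ->
  arc_reducible (simplex_chain R C 2 (s :\ v0)).
Proof.
move=> sC s3 v0s vP.
have sS : (s \in (C : {set {set 'I_n}})) && (#|s| == 3) by rewrite sC s3.
have bE := boundary_simplex R (Sub s sS : simplex_type C 3).
rewrite /= (bigD1 v0) //= in bE.
pose r := \sum_(v in s | v != v0) face_sign R s v *: simplex_chain R C 2 (s :\ v).
have rP : arc_reducible r.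
  by apply: arc_reducible_sum => v /andP[vs vv0]; apply: vP.
have bP : arc_reducible (boundary R C 2 (simplex_chain R C 3 s)) by eexists.
have -> : simplex_chain R C 2 (s :\ v0) = (face_sign R s v0)^-1 *:
   ((-1) *: r + boundary R C 2 (simplex_chain R C 3 s)) + 0.
  rewrite bE -/r addrCA scaleN1r addNr !addr0 scalerA mulVf ?scale1r //.
  exact: face_sign_neq0.
by apply: arc_reducible_lin; [apply: arc_reducible_lin|apply: arc_reducible0].
Qed.

(** Induction on the distance from [x] to [y] in the cut order. With [z] the successor of [x], the
    triangle on [x], [z], [y] trades the edge {x, y} for the arc edge {x, z} and the shorter edge
    {z, y}. *)
Lemma cut_reducible q c m (x y : 'I_n) : q \notin B c -> x \in B c -> y \in B c ->
  (cut q y = cut q x + m.+1)%N -> arc_reducible (simplex_chain R C 2 [set x; y]).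
Proof.
move=> qB; elim: m x => [|m IH] x xB yB xy;
  have xq : x != q by [apply: contraNneq qB => <-];
  have zq : ordS x != q by [apply: (cut_lt_ordS (i := y) xq); rewrite xy; lia];
  have zc := cut_ordS xq zq.
  apply: arc_edge_reducible; apply/existsP; exists x; apply/eqP.
  by congr [set _; _]; apply: (@cut_inj _ q); rewrite zc xy addn1.
have yq : y != q by apply: contraNneq qB => <-.
pose z := ordS x; rewrite -/z in zq zc.
(* Were [z] missed, [z] and [q] would separate [x] from [y], both in the ball. *)
have zB : z \in B c.
  apply/negPn/negP => zB; have := B_arc zB qB xB yB.
  move: xq yq zq zc xy; rewrite /separates /cut -!(inj_eq (@ord_inj n)).
  have := ltn_ord x; have := ltn_ord y; have := ltn_ord z; clear.
  by move=> zn yn xn; do 3 case: ltnP => ?; lia.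
have xz : x != z by apply/eqP => e; rewrite -e in zc; lia.
have xy' : x != y by apply/eqP => e; rewrite -e in xy; lia.
have zy' : z != y by apply/eqP => e; rewrite -e zc in xy; lia.
have sE := setD_triple xz zy' xy'.
rewrite -sE; apply: face_reducible.
- apply/CP; split; first by apply/set0Pn; exists x; rewrite !inE eqxx.
  by exists c; apply/fintype.subsetP => u; rewrite !inE => /orP[/orP[]|] /eqP ->.
- by rewrite -finset.setUA cardsU1 cards2 !inE negb_or xz xy' zy'.
- by rewrite !inE eqxx orbT.
move=> v; rewrite !inE => /orP[/orP[]|] /eqP -> vz.
- by rewrite sE; apply: IH; rewrite // zc xy addnS.
- by rewrite eqxx in vz.
- by rewrite sE; apply: arc_edge_reducible; apply/existsP; exists x.
Qed.

Lemma reducible z : arc_reducible z.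
Proof.
rewrite [z]chain_sum; apply: arc_reducible_sum => -[s /= sP] _.
have /andP[sC /cards2P[x [y [xy sE]]]] := sP; move: sC => /CP[_ [c]]; rewrite {s sP}sE => /fintype.subsetP sB.
have xB : x \in B c by apply: sB; rewrite !inE eqxx.
have yB : y \in B c by apply: sB; rewrite !inE eqxx orbT.
have [q qB _] := B_miss c c.
have := ltn_ord x; have := ltn_ord y => yn xn.
move: xy; rewrite -val_eqE /= => xy.
case: (ltngtP (cut q x) (cut q y)) => h.
- apply: (cut_reducible (m := (cut q y - cut q x).-1) qB) => //; lia.
- rewrite finset.setUC.
  apply: (cut_reducible (m := (cut q x - cut q y).-1) qB) => //; lia.
- by move: h; rewrite /cut; do 2 case: ltnP => ?; lia.
Qed.

(** Vanishing propagates from each edge to the next around the cycle. If {i0, i0+1} is not a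
    simplex, the last hypothesis holds vacuously, which is how a missing edge kills the homology. *)
Lemma arc_cycle_eq0 (i0 : 'I_n) (u : chains R C 2) : u \in cycles R C 1 ->
  (forall s, ~~ arc_edge (val s) -> u s = 0) ->
  (forall s, val s = [set i0; ordS i0] -> u s = 0) -> u = 0.
Proof.
move=> uZ uA u0.
suff uE k : forall i : 'I_n, i = ((i0 + k) %% n)%N :> nat ->
    forall s, val s = [set i; ordS i] -> u s = 0.
  apply/ffunP => s; rewrite ffunE; have [/existsP[i /eqP si]|/uA //] := boolP (arc_edge (val s)).
  (* Adding [n] first keeps the subtraction of naturals from truncating. *)
  apply: (uE (i + n - i0)%N i) => //.
  have := ltn_ord i; have := ltn_ord i0 => ? ?.
  by rewrite (_ : i0 + (i + n - i0) = i + n)%N ?modnDr ?modn_small //; lia.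
elim: k => [|k IH] i iE s sE.
  apply: u0; rewrite sE; suff -> : i = i0 by [].
  by apply: val_inj; rewrite /= iE addn0 modn_small.
have n0 : (0 < n)%N by lia.
pose j : 'I_n := Ordinal (ltn_pmod (i0 + k) n0).
have ij : i = ordS j.
  by apply: val_inj; rewrite /= iE addnS -[X in _ = (X %% _)%N]addn1 modnDml addn1.
have iSi : i != ordS i.
  by apply/eqP => /(congr1 (@nat_of_ord n)); have := ordS_cases i; lia.
have iC : ([set i] \in (C : {set {set 'I_n}})) && (#|[set i]| == 1).
  rewrite cards1 eqxx andbT; have /andP[sC _] := valP s.
  apply: (simplices_sub sC); first by rewrite sE finset.sub1set !inE eqxx.
  by apply/set0Pn; exists i; rewrite inE.
(* At the vertex [i] only {j, i} and {i, i+1} can contribute to the boundary, and the former has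
   coefficient 0 by induction. *)
move: uZ; rewrite memv_ker lfunE => /eqP/ffunP/(_ (Sub [set i] iC)).
rewrite !ffunE (bigD1 s) //= [X in _ + X]big1 ?addr0 => [|t ts].
  rewrite /= in sE; rewrite sE (big_pred1 (ordS i)) => [/eqP|v].
    by rewrite mulf_eq0 (negPf (face_sign_neq0 _ _ _)) => /eqP.
  rewrite !inE; case: (eqVneq v i) => [->|vi] /=.
    rewrite (negPf iSi) (setD_pair iSi) finset.eqEsubset.
    by apply/negbTE; rewrite negb_and finset.sub1set inE eq_sym iSi.
  case: (eqVneq v (ordS i)) => [->|//] /=.
  by rewrite (setD_pair iSi) eqxx.
apply: big1 => v /andP[vt /eqP tv].
suff -> : u t = 0 by rewrite mulr0.
have [/existsP[i' /eqP ti']|/uA //] := boolP (arc_edge (val t)).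
rewrite /= in ti' sE.
have : i \in sval t by rewrite -(finset.setD1K vt) tv !inE eqxx orbT.
rewrite ti' !inE => /orP[/eqP ii'|/eqP ii'].
  have ets : sval t = sval s by rewrite ti' sE ii'.
  by case/eqP: ts; apply: val_inj.
apply: (IH j) => //; rewrite [LHS]ti' -ij ii'; congr [set _; _].
by apply: ordS_inj; rewrite -ij -ii'.
Qed.

(* The arc of a ball joining [x < y] passes through the edge {n-1, 0} exactly
   when the ball misses some [q] with [x < q < y]. *)
Definition crossing (s : {set 'I_n}) := [exists x : 'I_n, exists y : 'I_n, exists c, exists q : 'I_n,
  [&& (x < q < y)%N, x \in s, y \in s, s \subset B c & q \notin B c]].

(** The answer does not depend on the ball or on the missed vertex. Any other choice [c'], [q'] is
    compared with [c], [q] through a vertex [r] missed by both balls. *)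
Lemma crossingE (x y q : 'I_n) c : (x < y)%N -> x \in B c -> y \in B c -> q \notin B c ->
  crossing [set x; y] = (x < q < y)%N.
Proof.
move=> xy xB yB qB; apply/idP/idP; last first.
  move=> xqy; apply/existsP; exists x; apply/existsP; exists y; apply/existsP; exists c.
  apply/existsP; exists q; rewrite xqy qB !inE !eqxx orbT /= andbT.
  by apply/fintype.subsetP => u; rewrite !inE => /orP[] /eqP ->.
case/existsP => x' /existsP[y' /existsP[c' /existsP[q' /and5P[xqy' x's y's sB' q'B']]]].
have xqy : (x < q' < y)%N.
  by move: x's y's; rewrite !inE -!val_eqE /=; lia.
have xB' : x \in B c' by apply: (fintype.subsetP sB'); rewrite !inE eqxx.
have yB' : y \in B c' by apply: (fintype.subsetP sB'); rewrite !inE eqxx orbT.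
have [r rB rB'] := B_miss c c'.
have neq (z : 'I_n) b : z \notin B b -> forall u : 'I_n, u \in B b -> (u : nat) != z.
  by move=> zB u uB; apply: contraNneq zB => /ord_inj <-.
have [rx ry] := (neq _ _ rB _ xB, neq _ _ rB _ yB).
have [qx qy] := (neq _ _ qB _ xB, neq _ _ qB _ yB).
apply: (not_separated_between (q' := q') (r := r)) => //.
  exact: (B_arc qB rB).
exact: (B_arc q'B' rB').
Qed.

(** One missed [q] serves all three faces. It differs from [y], so it lies between [x] and [z]
    exactly when it lies in one of the two subintervals, never in both. *)
Lemma crossing_cocycle (s : simplex_type C 3) :
  \sum_(v in val s) face_sign R (val s) v * (crossing (val s :\ v))%:R = 0.
Proof.
have /andP[/CP[_ [c sB]] /eqP /card3P[x [y [z [xy yz sE]]]]] := valP s.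
have [q qB _] := B_miss c c.
rewrite /= in sE; move: sB; rewrite /= sE => /fintype.subsetP sB.
have xB : x \in B c by apply: sB; rewrite !inE eqxx.
have yB : y \in B c by apply: sB; rewrite !inE eqxx !orbT.
have zB : z \in B c by apply: sB; rewrite !inE eqxx !orbT.
have xy' : x != y by rewrite -val_eqE /= ltn_eqF.
have yz' : y != z by rewrite -val_eqE /= ltn_eqF.
have xz : (x < z)%N by lia.
have xz' : x != z by rewrite -val_eqE /= ltn_eqF.
have qy : (y : nat) != q by apply: contraNneq qB => /ord_inj <-.
rewrite -finset.setUA big_setU1 ?inE ?negb_or ?xy' //= big_set2 // finset.setUA.
rewrite !(face_sign3 R xy yz) !(setD_triple xy' yz' xz').
rewrite (crossingE xy xB yB qB) (crossingE yz yB zB qB) (crossingE xz xB zB qB).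
rewrite (_ : (x < q < z)%N = (x < q < y)%N || (y < q < z)%N); last by lia.
have : ~~ ((x < q < y)%N && (y < q < z)%N) by lia.
by case: (x < q < y)%N; case: (y < q < z)%N => //= _; ring.
Qed.

(* Edges are oriented from the smaller to the larger vertex, which for {n-1, 0}
   is against the direction of [ordS]. *)
Definition wrap_sign (i : 'I_n) : R := if (i.+1 < n)%N then 1 else -1.

Definition round_chain : chains R C 2 :=
  \sum_i wrap_sign i *: simplex_chain R C 2 [set i; ordS i].

Lemma round_chain_arc s : ~~ arc_edge (val s) -> round_chain s = 0.
Proof.
move=> ns; rewrite sum_ffunE big1 // => i _; rewrite !ffunE.
case: eqP => [si|_]; last by rewrite scaler0.
by case/existsP: ns; exists i; apply/eqP.
Qed.

(** * The class of the round chain *)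

Section AllEdges.
Hypothesis C_edges : forall i : 'I_n, [set i; ordS i] \in (C : {set {set 'I_n}}).

Lemma ordS_neq (i : 'I_n) : i != ordS i.
Proof.
by apply/eqP => /(congr1 (@nat_of_ord n)); have := ordS_cases i; lia.
Qed.

Lemma edge_simplex (i : 'I_n) :
  ([set i; ordS i] \in (C : {set {set 'I_n}})) && (#|[set i; ordS i]| == 2).
Proof. by rewrite C_edges cards2 ordS_neq. Qed.

(** With these signs each edge has boundary end minus start in the direction of [ordS], and the sum
    around the cycle cancels. *)
Lemma round_chain_cycle : round_chain \in cycles R C 1.
Proof.
rewrite memv_ker linear_sum /=; apply/eqP.
pose e i := simplex_chain R C 1 [set i].
transitivity (\sum_i (e (ordS i) - e i)).
  apply: eq_bigr => i _; rewrite linearZ /=.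
  have := boundary_simplex R (Sub [set i; ordS i] (edge_simplex i) : simplex_type C 2).
  rewrite /= => ->; rewrite big_set2 ?ordS_neq // !(setD_pair (ordS_neq i)).
  rewrite /wrap_sign; have [[h Sh]|[h Sh]] := ordS_cases i.
    have iS : (i < ordS i)%N by rewrite Sh.
    by rewrite h !(face_sign2 R iS) scale1r scaleN1r scale1r.
  have iS : (ordS i < i)%N by lia.
  rewrite ltnNge h leqnn /= finset.setUC !(face_sign2 R iS) scale1r !scaleN1r.
  by rewrite opprD opprK.
by rewrite sumrB [X in _ - X](reindex_inj (@ordS_inj n)) subrr.
Qed.

(** Nothing lies strictly between [i] and [i+1], so only {n-1, 0} crosses, and its coefficient is
    -1. *)
Lemma round_chain_crossing :
  cochain (fun s => (crossing s)%:R) round_chain = -1.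
Proof.
have n0 : (n.-1 < n)%N by lia.
have qE i : exists c q, [/\ i \in B c, ordS i \in B c & q \notin B c].
  have /CP[_ [c sB]] := C_edges i; have [q qB _] := B_miss c c; exists c, q.
  by split => //; apply: (fintype.subsetP sB); rewrite !inE eqxx ?orbT.
rewrite linear_sum (bigD1 (Ordinal n0)) //= big1 ?addr0 => [|i iN].
  set i := Ordinal n0; have [c [q [iB SiB qB]]] := qE i.
  have [[]|[_ Si]] := ordS_cases i; first by rewrite /=; lia.
  rewrite linearZ /= (cochain_simplex _ (Sub [set i; ordS i] (edge_simplex i) : simplex_type C 2)) /=.
  have iS : (ordS i < i)%N by rewrite Si /=; lia.
  rewrite finset.setUC (crossingE iS SiB iB qB) /wrap_sign.
  have qi : (i : nat) != q by apply: contraNneq qB => /ord_inj <-.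
  have qSi : (ordS i : nat) != q by apply: contraNneq qB => /ord_inj <-.
  have := ltn_ord q; rewrite Si in qSi *; rewrite /= in qi * => qn.
  (* Being missed by a ball that contains both ends, [q] is neither 0 nor n-1. *)
  rewrite (_ : (0 < q < n.-1)%N); last by move: qi qSi qn; clear; lia.
  by rewrite (_ : (_ < n)%N = false) ?mulr1 //; clear -n_ge3; lia.
have [c [q [iB SiB qB]]] := qE i.
have iN' : (i : nat) != n.-1 by apply: contraNneq iN => ii; apply/eqP/ord_inj.
have [[h Si]|[h _]] := ordS_cases i; last by lia.
rewrite linearZ /= (cochain_simplex _ (Sub [set i; ordS i] (edge_simplex i) : simplex_type C 2)) /=.
have iS : (i < ordS i)%N by rewrite Si.
by rewrite (crossingE iS iB SiB qB) Si (_ : (i < q < i.+1)%N = false) ?mulr0 //; lia.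
Qed.

Lemma homology_round :
  exists h : homology R C 1, h <> 0 /\ forall h', exists c : R, h' = c *: h.
Proof.
pose phi := cochain (C := C) (m := 2) (fun s => (crossing s)%:R : R).
have phi_round : phi round_chain != 0 by rewrite /phi round_chain_crossing oppr_eq0 oner_eq0.
have n0 : (0 < n)%N by lia.
pose i0 := Ordinal n0; pose s0 : simplex_type C 2 := Sub [set i0; ordS i0] (edge_simplex i0).
have s0E s : val s = [set i0; ordS i0] -> s = s0 by move=> sE; apply: val_inj.
(* A cycle on arc edges that vanishes at [s0] is zero, whereas [phi] is nonzero on the round
   chain. *)
have rs0 : round_chain s0 != 0.
  apply/negP => /eqP rs0; case/negP: phi_round; rewrite /phi (_ : round_chain = 0) ?linear0 //.
  apply: (arc_cycle_eq0 (i0 := i0) round_chain_cycle round_chain_arc) => s /s0E ->.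
  exact: rs0.
apply: (homology_line round_chain_cycle).
  (* The cocycle [phi] vanishes on boundaries. *)
  apply/negP => /memv_imgP[d _ rE]; case/negP: phi_round; rewrite rE /phi.
  by rewrite cochain_boundary //; apply: crossing_cocycle.
move=> z zZ; have [d dE] := reducible z.
(* The scalar [a] makes [u] and the multiple of the round chain agree at [s0], hence everywhere. *)
pose u := z - boundary R C 2 d; pose a := u s0 / round_chain s0; exists a.
suff : u - a *: round_chain = 0.
  move/eqP; rewrite /u addrAC subr_eq0 => /eqP ->.
  exact: memv_img (memvf d).
apply: (arc_cycle_eq0 (i0 := i0)).
- rewrite !(memvB, memvZ) ?round_chain_cycle //.
  by apply: (subvP (boundaries_sub_cycles R C 1)); exact: memv_img (memvf d).
- by move=> s ns; rewrite !ffunE dE // subrr round_chain_arc // scaler0 subr0.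
- by move=> s /s0E ->; rewrite [LHS]ffunE [X in _ + X]ffunE [X in - X]ffunE /a /GRing.scale /= divfK // subrr.
Qed.

End AllEdges.

Lemma homology_cut_eq0 i : [set i; ordS i] \notin (C : {set {set 'I_n}}) ->
  forall h : homology R C 1, h = 0.
Proof.
move=> iC; apply: homology_eq0 => z zZ; have [d dE] := reducible z.
suff /eqP : z - boundary R C 2 d = 0.
  by rewrite subr_eq0 => /eqP ->; apply: memv_img (memvf d).
apply: (arc_cycle_eq0 (i0 := i)).
- rewrite memvB // (subvP (boundaries_sub_cycles R C 1)) //.
  exact: memv_img (memvf d).
- by move=> s ns; rewrite !ffunE dE // subrr.
- by move=> s sE; case/negP: iC; rewrite -sE; case/andP: (valP s).
Qed.

End CycleComplex.

(** * Path distances and reachability *)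

Section Paths.
Local Open Scope ereal_scope.
Variables (R : realType) (X : finType) (G : network R X).

Lemma path_weight_cat x p q :
  path_weight G x (p ++ q) = path_weight G x p + path_weight G (last x p) q.
Proof. by rewrite /path_weight pairmap_cat big_cat. Qed.

Lemma path_weight_cons x y p : path_weight G x (y :: p) = G x y + path_weight G y p.
Proof. by rewrite /path_weight /= big_cons. Qed.

Lemma path_dist_le x p : path_dist G x (last x p) <= path_weight G x p.
Proof. by apply: ereal_inf_lbound; exists p. Qed.

Lemma path_dist_ltP x y e : path_dist G x y < e ->
  exists2 p, last x p = y & path_weight G x p < e.
Proof. by move=> /ereal_inf_lt[_ [p py <-] pe]; exists p. Qed.

Lemma path_distxx x : path_dist G x x = 0.
Proof.
apply/eqP; rewrite eq_le path_dist_ge0 andbT.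
by apply: le_trans (path_dist_le x [::]) _; rewrite /path_weight big_nil.
Qed.

Lemma path_dist_edge x y : path_dist G x y <= G x y.
Proof.
have := path_dist_le x [:: y].
by rewrite path_weight_cons [X in _ + X]/path_weight big_nil adde0.
Qed.

Lemma path_dist_fin_trans x y z :
  path_dist G x y < +oo -> path_dist G y z < +oo -> path_dist G x z < +oo.
Proof.
move=> /path_dist_ltP[p py pw] /path_dist_ltP[q qz qw].
have := path_dist_le x (p ++ q); rewrite last_cat py qz => /le_lt_trans; apply.
by rewrite path_weight_cat py lte_add_pinfty.
Qed.

(** Cut the path at its first exit from [S]. As weights are nonnegative, the initial piece and the
    exit step each weigh at most the whole. *)
Lemma path_exit (S : pred X) x p : S x -> ~~ S (last x p) ->
  exists u u', [/\ S u, ~~ S u', path_dist G x u' <= path_weight G x p &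
                 G u u' <= path_weight G x p].
Proof.
move=> Sx Sl.
have [p1 [u' [p2 [-> Su Su']]]] : exists p1 u' p2,
    [/\ p = p1 ++ u' :: p2, S (last x p1) & ~~ S u'].
  elim: p x Sx Sl => [|y p IH] x Sx /=; first by rewrite Sx.
  move=> Sl; have [Sy|Sy] := boolP (S y); last by exists [::], y, p.
  by have [p1 [u' [p2 [-> ? ?]]]] := IH _ Sy Sl; exists (y :: p1), u', p2.
exists (last x p1), u'; split => //.
  rewrite -cat_rcons path_weight_cat.
  have := path_dist_le x (rcons p1 u'); rewrite last_rcons => /le_trans; apply.
  by rewrite leeDl // path_weight_ge0.
rewrite path_weight_cat path_weight_cons.
by rewrite addeCA leeDl // adde_ge0 // path_weight_ge0.
Qed.

Lemma minset_dominating_unreachable (K : {set X}) :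
  minset (source_dominating (path_completion G)) K -> (2 < #|K|)%N ->
  forall y y', exists2 q, path_dist G y q = +oo & path_dist G y' q = +oo.
Proof.
move=> /minsetP[Kdom Kmin] K3 y y'.
(* If [k] reached [k'], then [k'] could be dropped from [K]. *)
have sep k k' : k \in K -> k' \in K -> k != k' -> path_dist G k k' = +oo.
  move=> kK k'K kk'; apply/eqP; rewrite -leye_eq leNgt; apply/negP => dk.
  have /Kmin/(_ (subD1set _ _)) : source_dominating (path_completion G) (K :\ k').
    apply/forallP => x; have /existsP[j /andP[jK jx]] := forallP Kdom x.
    apply/existsP; have [jk|jk] := eqVneq j k'.
      exists k; rewrite !inE kk' kK /=; apply: path_dist_fin_trans dk _.
      by rewrite -jk.
    by exists j; rewrite !inE jk jK.
  by move/setP/(_ k'); rewrite !inE eqxx k'K.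
have /existsP[k /andP[kK ky]] := forallP Kdom y.
have /existsP[k' /andP[k'K ky']] := forallP Kdom y'.
(* A third member [q] of [K] cannot be reached from [y] or [y'], for then [k] or [k'] would reach it
   too. *)
have /card_gt0P[q] : (0 < #|K :\ k :\ k'|)%N.
  have := cardsD1 k K; have := cardsD1 k' (K :\ k); rewrite kK.
  by case: (k' \in _) => /=; lia.
rewrite !inE => /and3P[qk' qk qK].
exists q; apply/eqP; rewrite -leye_eq leNgt; apply/negP => dq.
  by have := path_dist_fin_trans ky dq; rewrite sep // eq_sym.
by have := path_dist_fin_trans ky' dq; rewrite sep // eq_sym.
Qed.

End Paths.

(** * Balls in a cycle graph *)

Section CycleGraph.
Local Open Scope ereal_scope.
Variables (R : realType) (n : nat) (G : network R 'I_n).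
Hypothesis hG : cycle_graph G.

Lemma cycle_graph_step (u u' : 'I_n) : u != u' -> G u u' < +oo ->
  u' = ordS u \/ u = ordS u'.
Proof.
move=> uu' Gu; have [|h1] := eqVneq u' (ordS u); first by left.
have [|h2] := eqVneq u (ordS u'); first by right.
by move: Gu; rewrite hG.2 // ltxx.
Qed.

Variables (delta : R) (y : 'I_n).
Let ball := [set x | path_dist G y x <= delta%:E].

(** The distance is an infimum, so a path of weight at most [delta] need not be at hand; one
    strictly below two larger bounds always is. *)
Lemma ball_path x v w : x \in ball -> delta%:E < v -> delta%:E < w ->
  exists p, [/\ last y p = x, path_weight G y p < v & path_weight G y p < w].
Proof.
rewrite inE => xB vd wd.
have /path_dist_ltP[p px] : path_dist G y x < Order.min v w.
  by apply: le_lt_trans xB _; rewrite lt_min vd.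
by rewrite lt_min => /andP[]; exists p.
Qed.

(** A path to [x] lighter than the distances to [v] and [w] meets neither of them, and a single step
    between other vertices cannot change arc. *)
Lemma ball_side (v w x : 'I_n) : (0 <= delta)%R -> v \notin ball -> w \notin ball ->
  x \in ball -> separates v w x = separates v w y.
Proof.
move=> d0 vB wB xB.
have yB : y \in ball by rewrite inE path_distxx lee_fin.
have vd : delta%:E < path_dist G y v by move: vB; rewrite inE ltNge.
have wd : delta%:E < path_dist G y w by move: wB; rewrite inE ltNge.
have [p [px pv pw]] := ball_path xB vd wd.
apply/eqP/negPn/negP => xy.
pose S (u : 'I_n) := [&& u != v, u != w & separates v w u == separates v w y].
have Sy : S y.
  rewrite /S eqxx andbT; apply/andP; split.
    by apply: contraNneq vB => <-.
  by apply: contraNneq wB => <-.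
have Sx : ~~ S (last y p) by rewrite px /S (negPf xy) !andbF.
have [u [u' [Su Su' du' Guu']]] := path_exit G Sy Sx.
have u'v : u' != v by apply: contraTneq du' => ->; rewrite -ltNge.
have u'w : u' != w by apply: contraTneq du' => ->; rewrite -ltNge.
have uu' : u != u' by apply: contraNneq Su' => <-.
have Gfin : G u u' < +oo.
  by apply: le_lt_trans Guu' (lt_le_trans pv _); rewrite leey.
have step := cycle_graph_step uu' Gfin.
case/negP: Su'; rewrite /S u'v u'w /=.
move: Su => /and3P[uv uw /eqP <-]; move: u'v u'w uv uw step.
rewrite /separates -!val_eqE /=; have := ordS_cases u; have := ordS_cases u'.
have := ltn_ord u; have := ltn_ord u'; have := ltn_ord w; have := ltn_ord v; clear => vn wn u'n un Su' Su.
move=> u'v u'w uv uw [] /(congr1 (@nat_of_ord n)) => e; apply/eqP; lia.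
Qed.

(** A path from the centre that avoids [q] can reach the far end of the edge only by traversing it,
    yet the path can be chosen lighter than the edge. *)
Lemma heavy_edge_uncovered (i q : 'I_n) : (0 <= delta)%R -> q \notin ball ->
  delta%:E < G i (ordS i) -> delta%:E < G (ordS i) i ->
  ~~ ([set i; ordS i] \subset ball).
Proof.
move=> d0 qB Gi Gi'; apply/negP => /fintype.subsetP sB.
have iB : i \in ball by apply: sB; rewrite !inE eqxx.
have SiB : ordS i \in ball by apply: sB; rewrite !inE eqxx orbT.
have yB : y \in ball by rewrite inE path_distxx lee_fin.
have qd : delta%:E < path_dist G y q by move: qB; rewrite inE ltNge.
have neq (u : 'I_n) : u \in ball -> u != q by move=> uB; apply: contraNneq qB => <-.
have exitP (S : pred 'I_n) x g : x \in ball -> delta%:E < g -> S y -> ~~ S x ->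
    exists u u', [/\ S u, ~~ S u', u' != q, G u u' < g & u' = ordS u \/ u = ordS u'].
  move=> xB gd Sy Sx; have [p [px pq pg]] := ball_path xB qd gd.
  have [|u [u' [Su Su' du' Guu']]] := path_exit G Sy (p := p); first by rewrite px.
  have Gg : G u u' < g by apply: le_lt_trans Guu' pg.
  exists u, u'; split=> //; first by apply: contraTneq du' => ->; rewrite -ltNge.
  apply: cycle_graph_step; first by apply: contraNneq Su' => <-.
  by apply: lt_le_trans Gg _; rewrite leey.
(* In the order cut at [q], the centre lies either up to [i], with [ordS i] as the far end, or
   beyond [i], with [i] as the far end. *)
have [yi|yi] := leqP (cut q y) (cut q i).
  pose S u := (u != q) && (cut q u <= cut q i)%N.
  have SSi : ~~ S (ordS i).
    by rewrite /S neq //= -ltnNge cut_ordS ?neq.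
  have [|u [u' [/andP[uq ui] u'S u'q Gu step]]] := exitP S _ _ SiB Gi _ SSi.
    by rewrite /S neq.
  rewrite /S u'q /= -ltnNge in u'S.
  have [uE u'E] := cut_step uq u'q (neq _ iB) (neq _ SiB) step ui u'S.
  by rewrite uE u'E ltxx in Gu.
pose S u := (u != q) && (cut q i < cut q u)%N.
have Si : ~~ S i by rewrite /S ltnn andbF.
have [|u [u' [/andP[uq ui] u'S u'q Gu step]]] := exitP S _ _ iB Gi' _ Si.
  by rewrite /S neq.
rewrite /S u'q /= -leqNgt in u'S.
(* Here the exit goes downwards, so [cut_step] is applied to the reversed step. *)
have {}step : u = ordS u' \/ u' = ordS u by case: step; [right|left].
have [u'E uE] := cut_step u'q uq (neq _ iB) (neq _ SiB) step u'S ui.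
by rewrite uE u'E ltxx in Gu.
Qed.

End CycleGraph.

Theorem proposition16 (R : realType) (n : nat) (hn : (3 <= n)%N)
    (G : network R 'I_n) (hG : cycle_graph G)
    (hor : inconsistently_oriented G)
    (M : R) (hM : max_edge_weight G M)
    (K : {set 'I_n})
    (hK : minset (source_dominating (path_completion G)) K)
    (hK3 : (3 <= #|K|)%N) :
  (forall delta : R, M <= delta ->
     exists h : homology R (dowker_complex G delta) 1,
       h <> 0 /\ forall h', exists c : R, h' = c *: h) /\
  (forall delta : R, 0 <= delta -> delta < M ->
     forall h : homology R (dowker_complex G delta) 1, h = 0).
Proof.
pose B delta y := [set x | (path_dist G y x <= delta%:E)%E].
have B_miss delta y y' : exists2 q, q \notin B delta y & q \notin B delta y'.
  have [q yq y'q] := minset_dominating_unreachable hK hK3 y y'.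
  by exists q; rewrite inE (yq, y'q) leye_eq.
have CP delta (s : {set 'I_n}) : s \in (dowker_complex G delta : {set {set 'I_n}}) <->
    s != finset.set0 /\ exists y, s \subset B delta y.
  rewrite inE; split.
    move=> /andP[-> /existsP[y /forall_inP sy]]; split => //; exists y.
    by apply/fintype.subsetP => x /sy; rewrite inE.
  move=> [-> [y /fintype.subsetP sy]]; apply/existsP; exists y.
  by apply/forall_inP => x /sy; rewrite inE.
have B_arc delta (d0 : 0 <= delta) (y v w x x' : 'I_n) :
    v \notin B delta y -> w \notin B delta y ->
    x \in B delta y -> x' \in B delta y -> separates v w x = separates v w x'.
  move=> vB wB xB x'B.
  by rewrite (ball_side hG d0 vB wB xB) (ball_side hG d0 vB wB x'B).
have [[i0 Mi0] Mmax] := hM.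
have M0 : 0 <= M.
  by rewrite -lee_fin; case: Mi0 => <-; apply: weight_ge0.
split => delta.
  move=> Md; have d0 := le_trans M0 Md.
  refine (@homology_round R n hn (B delta) _ (@CP delta) (B_arc _ d0) (@B_miss delta) _) => i.
  have edge_le u u' : (G u u' < +oo)%E ->
      (forall w, G u u' = w%:E -> edge_weights G w) -> (path_dist G u u' <= delta%:E)%E.
    move=> Gfin Gedge; apply: le_trans (path_dist_edge G u u') _; move: Gfin Gedge.
    have := weight_ge0 G u u'; case: (G u u') => [w _ _|//|//] Gedge.
    by rewrite lee_fin; apply: le_trans (Mmax _ (Gedge _ erefl)) Md.
  apply/CP; split; first by apply/set0Pn; exists i; rewrite !inE eqxx.
  (* The ball around the tail of the edge contains both ends. *)
  have := hG.1 i; have [Gi _|_ /= Gi] := boolP (G i (ordS i) < +oo)%E.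
    exists i; apply/fintype.subsetP => u; rewrite !inE => /orP[] /eqP ->.
      by rewrite path_distxx lee_fin.
    by apply: edge_le => // w Gw; exists i; left.
  exists (ordS i); apply/fintype.subsetP => u; rewrite !inE => /orP[] /eqP ->.
    by apply: edge_le => // w Gw; exists i; right.
  by rewrite path_distxx lee_fin.
move=> d0 dM; apply: (homology_cut_eq0 hn (@CP delta) (B_arc _ d0) (@B_miss delta) (i := i0)).
(* One direction has weight [M], and the other is infinite since only one of the two is finite. *)
have [Gi Gi'] : (delta%:E < G i0 (ordS i0) /\ delta%:E < G (ordS i0) i0)%E.
  have := hG.1 i0; case: Mi0 => Gi; rewrite Gi ltry ?addbT /= lte_fin dM.
    by rewrite ltey negbK => /eqP ->; rewrite ltry.
  by rewrite ltey negbK => /eqP ->; rewrite ltry.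
apply/negP => /CP[_ [y]]; apply/negP.
have [q qB _] := B_miss delta y y.
exact: heavy_edge_uncovered d0 qB Gi Gi'.
Qed.
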